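(* Let $\mathcal{S}$ and $\mathcal{T}$ be any domains (probability distributions) on $X\times Y$, let $\delta\in(0,1]$, and let $b>0$, $c>0$ be real numbers. Put $$b'=\frac{b}{1-e^{-b}}\,\beta_\infty(\mathcal{T}\|\mathcal{S}),\qquad c'=\frac{c}{1-e^{-c}} .$$ Then, with probability at least $1-\delta$ over the choices of $S\sim(\mathcal{S})^{m_s}$ and $T\sim(\mathcal{T}_X)^{m_t}$, for all $w\in\mathbb{R}^d$, $$R_{\mathcal{T}}(h_w)\ \le\ c'\,\widehat d_T(\rho_w)+2\,b'\,\widehat e_S(\rho_w)+2\,\eta_{\mathcal{T}\setminus\mathcal{S}}+2\left(\frac{c'}{m_t\times c}+\frac{b'}{m_s\times b}\right)\Big(\|w\|^2+\ln\tfrac2\delta\Big).$$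
   Context: Setting: $X\subseteq\mathbb{R}^d$, $Y=\{-1,1\}$; $\mathcal{T}_X$ is the marginal of $\mathcal{T}$ on $X$; $m_s,m_t\ge1$ are integers; $P^m$ is the distribution of $m$ i.i.d. draws from $P$, and $(S,T)\sim(\mathcal{S})^{m_s}\times(\mathcal{T}_X)^{m_t}$. $\mathcal{S}$ and $\mathcal{T}$ are given by densities $\mathcal{S}(x,y)$, $\mathcal{T}(x,y)$ with respect to a common dominating measure, and $\mathrm{supp}(\mathcal{S})=\{(x,y):\mathcal{S}(x,y)>0\}$, and similarly for $\mathcal{T}$. $I[a]=1$ if $a$ is true and $0$ otherwise; $\|\cdot\|$ is the Euclidean norm. Linear classifiers: $h_w(x)=\mathrm{sgn}(w\cdot x)$ for $w\in\mathbb{R}^d$, with $\mathrm{sgn}$ valued in $\{-1,1\}$ (a fixed value being chosen for $\mathrm{sgn}(0)$), and $\mathcal{H}=\{h_{w'}: w'\in\mathbb{R}^d\}$. For $w\in\mathbb{R}^d$, $\rho_w$ is the distribution on $\mathcal{H}$ of $h_{w'}$ where $w'$ is Gaussian on $\mathbb{R}^d$ with mean $w$ and identity covariance. Risk: $R_P(h)=\mathbf{E}_{(x,y)\sim P}I[h(x)\ne y]$. Empirical target disagreement, for $T=\{x'_i\}_{i=1}^{m_t}$: $\widehat d_T(\rho)=\frac1{m_t}\sum_{i=1}^{m_t}\mathbf{E}_{h\sim\rho}\mathbf{E}_{h'\sim\rho}I[h(x'_i)\ne h'(x'_i)]$. Empirical source joint error, for $S=\{(x_i,y_i)\}_{i=1}^{m_s}$: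 $\widehat e_S(\rho)=\frac1{m_s}\sum_{i=1}^{m_s}\mathbf{E}_{h\sim\rho}\mathbf{E}_{h'\sim\rho}I[h(x_i)\ne y_i]\,I[h'(x_i)\ne y_i]$. Divergence: $\beta_\infty(\mathcal{T}\|\mathcal{S})=\sup_{(x,y)\in\mathrm{supp}(\mathcal{S})}\frac{\mathcal{T}(x,y)}{\mathcal{S}(x,y)}$. If it is $+\infty$, the right-hand side of the bound is read as $+\infty$. $\mathcal{T}\setminus\mathcal{S}$ denotes the distribution of $(x,y)\sim\mathcal{T}$ conditional on $(x,y)\in\mathrm{supp}(\mathcal{T})\setminus\mathrm{supp}(\mathcal{S})$, and $\eta_{\mathcal{T}\setminus\mathcal{S}}=\Pr_{(x,y)\sim\mathcal{T}}\big((x,y)\notin\mathrm{supp}(\mathcal{S})\big)\,\sup_{h\in\mathcal{H}}R_{\mathcal{T}\setminus\mathcal{S}}(h)$, understood as $0$ when the probability factor is $0$. *)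

(* Defs.v *)
From HB Require Import structures.
From mathcomp Require Import all_boot all_order all_algebra.
From mathcomp Require Import all_classical all_reals all_analysis.
From mathcomp Require Import measurable_realfun.

Set Implicit Arguments.
Unset Strict Implicit.
Unset Printing Implicit Defensive.
Import Order.TTheory GRing.Theory Num.Theory.
Import numFieldNormedType.Exports.
Local Open Scope classical_set_scope.
Local Open Scope ring_scope.

(* A nonempty subset A of a measurable space T, not necessarily measurable, is
   itself a measurable space for the trace sigma-algebra. Nonemptiness is needed
   because measurable types are pointed. *)
Definition trace {disp} {T : measurableType disp} (A : set T)
  (A0 : A !=set0) : Type := set_type A.

Section trace_instance.
Context {disp} {T : measurableType disp} (A : set T) (A0 : A !=set0).

HB.instance Definition _ := Choice.on (trace A0).
HB.instance Definition _ := isPointed.Build (trace A0)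
  (exist _ (projT1 (cid A0)) (mem_set (projT2 (cid A0)))).

Definition trace_val (x : trace A0) : T := set_val x.

Let preT := g_sigma_algebra_preimageType trace_val.

HB.instance Definition _ := @isMeasurable.Build (preimage_display trace_val)
  (trace A0) (g_sigma_algebra_preimage trace_val)
  (@measurable0 _ preT) (@measurableC _ preT) (@bigcupT_measurable _ preT).

Lemma measurable_trace_val : measurable_fun setT trace_val.
Proof. by move=> _ B mB; exists B. Qed.

End trace_instance.

Section product_tuple.
Context {disp} {T : measurableType disp} {R : realType}.

Definition cons_pair n (p : T * n.-tuple T) : n.+1.-tuple T :=
  [the n.+1.-tuple T of p.1 :: p.2].

Lemma measurable_cons_pair n : measurable_fun setT (@cons_pair n).
Proof. exact: measurable_cons. Qed.

HB.instance Definition _ n :=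
  isMeasurableFun.Build _ _ _ _ (@cons_pair n) (@measurable_cons_pair n).

(* The law on n.-tuple T of independent coordinates, the i-th of law P i. *)
Fixpoint prod_tuple n : ('I_n -> probability T R) -> probability (n.-tuple T) R :=
  match n with
  | 0 => fun _ => @dirac _ (0.-tuple T) [tuple] R
  | n'.+1 => fun P =>
      distribution (P ord0 \x prod_tuple (fun i => P (lift ord0 i)))%E
                   (@cons_pair n')
  end.

Lemma prod_tuple_box n (P : 'I_n -> probability T R) (A : 'I_n -> set T) :
  (forall i, measurable (A i)) ->
  prod_tuple P [set u | forall i, A i (tnth u i)] = (\prod_(i < n) P i (A i))%E.
Proof.
elim: n P A => [|n IH] P A mA /=.
  by rewrite big_ord0 /dirac indicE mem_set// => -[].
pose B := [set u : n.-tuple T | forall i, A (lift ord0 i) (tnth u i)].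
have mB : measurable B.
  rewrite [B](_ : _ =
      \bigcap_(i in [set: 'I_n]) ((@tnth _ T ^~ i) @^-1` A (lift ord0 i))).
    apply: fin_bigcap_measurable => // i _.
    by rewrite -[X in measurable X]setTI; exact: measurable_tnth.
  by apply/seteqP; split => u /= Au i; [move=> _|]; apply: Au.
rewrite big_ord_recl -IH => [|i]; last exact: mA.
rewrite -[in RHS]product_measure1E//.
rewrite /distribution /pushforward; congr (product_measure1 _ _ _).
apply/seteqP; split => [[x u] /= Axu|[x u] /= [Ax Au] i].
  split=> [|i]; first by have := Axu ord0.
  by have := Axu (lift ord0 i); rewrite tnthS.
by case: (unliftP ord0 i) => [j|] -> //; rewrite tnthS; exact: Au.
Qed.

Definition iid n (P : probability T R) : probability (n.-tuple T) R :=
  prod_tuple (fun _ : 'I_n => P).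

End product_tuple.

(* Events quantified over uncountably many w need not be measurable, so the
   probability of E is bounded through a measurable subset of E. *)
Definition with_prob_ge {disp} {T : measurableType disp} {R : realType}
    (P : probability T R) (p : R) (E : set T) :=
  exists A : set T, [/\ measurable A, A `<=` E & (p%:E <= P A)%E].

(* Binary classifiers on Z, with the sigma-algebra generated by the evaluations
   h |-> h z. The label set {-1, 1} is rendered by bool: true is 1, false is -1. *)
Definition classifier (Z : Type) : Type :=
  g_sigma_algebraType [set A : set (Z -> bool) | exists z, A = [set h | h z]].

HB.instance Definition _ (Z : Type) := Measurable.on (classifier Z).

Section normal1.
Context {R : realType}.

(* normal_prob lives on measurableTypeR R, whose measurable sets are those of R
   but whose display differs; idTR transports it to R. *)
Definition idTR : measurableTypeR R -> R := idfun.

HB.instance Definition _ :=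
  isMeasurableFun.Build _ _ _ _ idTR (@measurable_id _ _ setT).

(* N(m, 1) *)
Definition normal1 (m : R) : probability R R :=
  distribution (normal_prob m 1) idTR.

End normal1.

Section linear_classifiers.
Context {R : realType} {d : nat}.
Implicit Types u v w : d.-tuple R.

Definition dot u v : R := \sum_(i < d) tnth u i * tnth v i.

Definition enorm u : R := Num.sqrt (\sum_(i < d) tnth u i ^+ 2).

(* sgn with the value s0 at 0 *)
Definition sgn (s0 : bool) (r : R) : bool := if r == 0 then s0 else 0 < r.

Context (s0 : bool) {X : set (d.-tuple R)} (X0 : X !=set0).

Definition lin w : classifier (trace X0) :=
  fun x => sgn s0 (dot w (trace_val x)).

Definition linH : set (classifier (trace X0)) := range lin.

Lemma linH_nonempty : linH !=set0.
Proof. by exists (lin point); exists point. Qed.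

Definition lin_in_H w : trace linH_nonempty :=
  exist _ (lin w) (mem_set (imageT lin w)).

Lemma measurable_lin_in_H : measurable_fun setT lin_in_H.
Proof.
have mlin : measurable_fun setT lin.
  apply: measurability => // _ [_ [x ->] <-]; rewrite setTI.
  have mdot : measurable_fun setT (dot ^~ (trace_val x)).
    apply: measurable_sum => i; apply: measurable_funM => //.
    exact: measurable_tnth.
  have msgn : measurable_fun setT (fun w => lin w x).
    apply: measurable_fun_ifT => //.
      exact: measurable_fun_eqr.
    exact: measurable_fun_ltr.
  by have := msgn measurableT [set true] I; rewrite setTI.
by move=> _ _ [B mB <-]; have := mlin measurableT B mB; rewrite !setTI.
Qed.

HB.instance Definition _ :=
  isMeasurableFun.Build _ _ _ _ lin_in_H measurable_lin_in_H.

(* N(w, I_d): independent coordinates, the i-th of law N(w_i, 1) *)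
Definition gauss w : probability (d.-tuple R) R :=
  prod_tuple (fun i => normal1 (tnth w i)).

Definition rho w : probability (trace linH_nonempty) R :=
  distribution (gauss w) lin_in_H.

End linear_classifiers.
Arguments lin {R d} s0 {X} X0 w _.
Arguments linH {R d} s0 {X} X0 _.
Arguments rho {R d} s0 {X} X0 w.

Section risks.
Local Open Scope ereal_scope.
Context {R : realType} {disp} {Z : measurableType disp}.

Definition risk (P : probability (Z * bool)%type R) (h : classifier Z) : \bar R :=
  \int[P]_z ((h z.1 != z.2)%:R)%:E.

Definition input (z : Z * bool) : Z := z.1.

HB.instance Definition _ :=
  isMeasurableFun.Build _ _ _ _ input measurable_fst.

Definition marginal (P : probability (Z * bool)%type R) : probability Z R :=
  distribution P input.

Context {H : set (classifier Z)} {H0 : H !=set0}.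

Definition emp_disagreement m (T : m.-tuple Z)
    (Q : probability (trace H0) R) : \bar R :=
  (m%:R^-1)%:E * \sum_(i < m) \int[Q]_h \int[Q]_h'
    ((trace_val h (tnth T i) != trace_val h' (tnth T i))%:R)%:E.

Definition emp_joint_error m (S : m.-tuple (Z * bool))
    (Q : probability (trace H0) R) : \bar R :=
  (m%:R^-1)%:E * \sum_(i < m) \int[Q]_h \int[Q]_h'
    ((trace_val h (tnth S i).1 != (tnth S i).2)%:R *
     (trace_val h' (tnth S i).1 != (tnth S i).2)%:R)%:E.

End risks.

Section densities.
Local Open Scope ereal_scope.
Context {R : realType} {disp} {Z : measurableType disp}.
Implicit Types s t : {mfun Z >-> R}.

Definition is_density (mu : {measure set Z -> \bar R}) (P : probability Z R) s :=
  (forall z, (0 <= s z)%R) /\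
  (forall A, measurable A -> P A = \int[mu]_(z in A) (s z)%:E).

Definition supp s : set Z := [set z | (0 < s z)%R].

Lemma measurable_supp s : measurable (supp s).
Proof.
have ms : measurable_fun setT (fun z => (0 < s z)%R).
  exact: measurable_fun_ltr.
by have := ms measurableT [set true] I; rewrite setTI.
Qed.

Definition beta_infty t s : \bar R := ereal_sup [set (t z / s z)%:E | z in supp s].

(* The conditional law of P given D; it is P itself when P D = 0. *)
Definition cond_law (P : probability Z R) (D : set Z) (mD : measurable D) :
  probability Z R := mnormalize (mrestr P mD) P.

(* T \ S for T, S of densities t, s *)
Definition law_diff (T : probability Z R) t s : probability Z R :=
  cond_law T (measurableD (measurable_supp t) (measurable_supp s)).

End densities.

(* When the probability factor is 0 the product is 0, whatever law_diff is. *)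
Definition eta_diff {R : realType} {disp} {Z : measurableType disp}
    (H : set (classifier Z)) (T : probability (Z * bool)%type R)
    (t s : {mfun (Z * bool)%type >-> R}) : \bar R :=
  (T (~` supp s) * ereal_sup [set risk (law_diff T t s) h | h in H])%E.

(* Main.v *)
Require Import Defs.
From HB Require Import structures.
From mathcomp Require Import all_boot all_order all_algebra.
From mathcomp Require Import all_classical all_reals all_analysis.
From mathcomp Require Import measurable_realfun ring lra.

(** For f = I[h(x) <> h'(x)] or f = I[h(x) <> y] I[h'(x) <> y] and the prior
    pi = N(0, I) x N(0, I) on pairs of weight vectors, the exponential
    exp (m (1 - exp (-c)) E f - c sum_i f(z_i)) has mean at most 1 over the
    sample, so by Markov's inequality its pi-average is at most 2/delta with
    probability at least 1 - delta/2. Changing the measure to the posterior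
    N(w, I) x N(w, I), at relative entropy |w|^2 from pi, gives the PAC-Bayes
    bounds on the target disagreement and on the source joint error for all w
    at once. The two samples being independent, both bounds hold with
    probability at least (1 - delta/2)^2 >= 1 - delta.

    The reflection v |-> 2w - v preserves N(w, I), and h_w(x) is always h_v(x)
    or h_(2w - v)(x). Hence R_T(h_w) is at most twice the risk of the Gibbs
    classifier, that is, the expected disagreement plus twice the expected
    joint error on the target; the latter is at most beta times the one on the
    source, plus eta. *)

Set Implicit Arguments.
Unset Strict Implicit.
Unset Printing Implicit Defensive.
Import Order.TTheory GRing.Theory Num.Theory.
Import numFieldNormedType.Exports.
Local Open Scope classical_set_scope.
Local Open Scope ring_scope.

(** * Gaussian integrals *)

Import HBNNSimple.

(** By monotone convergence both sides are limits along simple functions increasing to [f]. For a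
    simple function, linearity reduces the identity to its level sets, where it is the hypothesis on
    [nu]. *)
Lemma ge0_integral_density {d} {T : measurableType d} {R : realType}
    (mu nu : {measure set T -> \bar R}) (p : T -> R) (f : T -> \bar R) :
    measurable_fun setT p -> (forall x, 0 <= p x) ->
    (forall A, measurable A -> nu A = \int[mu]_(x in A) (p x)%:E)%E ->
    measurable_fun setT f -> (forall x, 0 <= f x)%E ->
  (\int[nu]_x f x = \int[mu]_x (f x * (p x)%:E))%E.
Proof.
move=> mp p0 nuE mf f0.
have mpE : measurable_fun setT (fun x => (p x)%:E) by exact/measurable_EFinP.
pose f_ := nnsfun_approx measurableT mf.
have f_f x : (f_ n x)%:E @[n --> \oo] --> f x by exact: cvg_nnsfun_approx.
have nd x : {homo (fun n => (f_ n x)%:E) : m n / (m <= n)%N >-> (m <= n)%E}.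
  by move=> m n mn; rewrite lee_fin; exact/lefP/nd_nnsfun_approx.
transitivity (limn (fun n => \int[nu]_x (f_ n x)%:E)%E).
  rewrite -monotone_convergence//.
  - by apply: eq_integral => x _; apply/esym/cvg_lim => //; exact: f_f.
  - by move=> n; exact/measurable_EFinP/measurable_funTS.
  - by move=> n x _; rewrite lee_fin.
transitivity (limn (fun n => \int[mu]_x ((f_ n x)%:E * (p x)%:E))%E); last first.
  rewrite -monotone_convergence//.
  - apply: eq_integral => x _; apply/cvg_lim => //.
    by apply: cvgeZr => //; exact: f_f.
  - by move=> n; apply: emeasurable_funM => //; exact/measurable_EFinP.
  - by move=> n x _; rewrite mule_ge0// lee_fin.
  - by move=> x _ m n mn; rewrite lee_wpmul2r ?lee_fin//; exact: nd.
congr (limn _); apply/funext => n.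
under eq_integral do rewrite fimfunE -fsumEFin//.
rewrite ge0_integral_fsum//; last 2 first.
  - by move=> r; exact/measurable_EFinP/measurable_funM.
  - by move=> r x _; rewrite EFinM nnfun_muleindic_ge0.
under [RHS]eq_integral.
  move=> x _; rewrite fimfunE -fsumEFin// ge0_mule_fsuml; last first.
    by move=> r; rewrite EFinM nnfun_muleindic_ge0.
  over.
rewrite [RHS]ge0_integral_fsum//; last 2 first.
  - move=> r; apply: emeasurable_funM => //.
    exact/measurable_EFinP/measurable_funM.
  - by move=> r x _; rewrite mule_ge0 ?EFinM ?nnfun_muleindic_ge0 ?lee_fin.
apply: eq_fsbigr => r; rewrite inE => -[x _ <-].
rewrite integralZl_indic_nnsfun// integral_indic// setIT.
under [RHS]eq_integral do rewrite EFinM -muleA.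
rewrite ge0_integralZl ?lee_fin//; last 2 first.
  - by apply: emeasurable_funM => //; exact/measurable_EFinP.
  - by move=> y _; rewrite mule_ge0// lee_fin.
congr (_ * _)%E; rewrite nuE// integral_mkcond.
apply: eq_integral => y _; rewrite patchE indicE muleC.
by case: ifPn => _; rewrite ?mule1 ?mule0.
Qed.

Section reflection.
Context {R : realType}.
Local Notation mu := (@lebesgue_measure R).

Lemma measurable_fun_subl (a : R) :
  measurable_fun [set: R] (fun x : R => a - x).
Proof. exact: measurable_funB. Qed.

(** Lebesgue measure is determined by its values on half-open intervals. Reflection turns []x, y]]
    into [[a - y, a - x[], closed at the other end but of the same length. *)
Lemma lebesgue_measure_subl (a : R) (A : set R) : measurable A ->
  pushforward mu ((fun x => a - x) : _ -> measurableTypeR R) A = mu A.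
Proof.
move=> mA.
have mphi : measurable_fun [set: measurableTypeR R]
    ((fun x => a - x) : _ -> measurableTypeR R) by exact: measurable_fun_subl.
(* Bundled as a measurable function, the reflection has a pushforward that is inferred to be a
   measure. *)
pose phi : {mfun measurableTypeR R >-> measurableTypeR R} :=
  HB.pack ((fun x => a - x) : measurableTypeR R -> measurableTypeR R)
   (isMeasurableFun.Build _ _ _ _ _ mphi).
apply/esym/(@lebesgue_measure_unique _ (pushforward mu phi)) => //= _ [[x y]] _ <-.
rewrite /pushforward /= (_ : _ @^-1` _ = `[a - y, a - x[%classic).
  by rewrite !lebesgue_measure_itv/= !lte_fin ltrD2l ltrN2 -!EFinB;
     case: ifPn => // _; congr (_%:E); ring.
by apply/seteqP; split => z /=; rewrite !in_itv/=; lra.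
Qed.

Lemma ge0_integral_subl (a : R) (f : R -> \bar R) :
  measurable_fun [set: R] f -> (forall x, 0 <= f x)%E ->
  (\int[mu]_x f (a - x)%R = \int[mu]_x f x)%E.
Proof.
move=> mf f0.
have mphi : measurable_fun [set: measurableTypeR R]
    ((fun x => a - x) : _ -> measurableTypeR R) by exact: measurable_fun_subl.
pose phi : {mfun measurableTypeR R >-> measurableTypeR R} :=
  HB.pack ((fun x => a - x) : measurableTypeR R -> measurableTypeR R)
   (isMeasurableFun.Build _ _ _ _ _ mphi).
transitivity (\int[pushforward mu phi]_x f x)%E.
  by rewrite (ge0_integral_pushforward mphi).
by apply: eq_measure_integral => A mA _; exact: lebesgue_measure_subl.
Qed.

End reflection.

Section normal1_integral.
Context {R : realType}.
Local Notation mu := (@lebesgue_measure R).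

Lemma normal_pdf1E (m x : R) :
  normal_pdf m 1 x = normal_peak (1 : R) * expR (- ((x - m) ^+ 2 / 2)).
Proof.
by rewrite (@normal_pdfE _ m 1 (oner_neq0 _)) /normal_fun mulNr expr1n.
Qed.

Lemma ge0_integral_normal1 (m : R) (f : R -> \bar R) :
  measurable_fun [set: R] f -> (forall x, 0 <= f x)%E ->
  (\int[normal1 m]_x f x = \int[mu]_x (f x * (normal_pdf m 1 x)%:E))%E.
Proof.
move=> mf f0; rewrite ge0_integral_distribution//=.
rewrite (@ge0_integral_density _ _ _ mu _ (normal_pdf m 1))//.
- exact: measurable_normal_pdf.
- by move=> x; exact: normal_pdf_ge0.
Qed.

(** The density of N(m, 1) is symmetric about [m], and Lebesgue measure is invariant under the
    reflection about [m]. *)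
Lemma ge0_integral_normal1_reflect (m : R) (f : R -> \bar R) :
  measurable_fun [set: R] f -> (forall x, 0 <= f x)%E ->
  (\int[normal1 m]_x f (m *+ 2 - x)%R = \int[normal1 m]_x f x)%E.
Proof.
move=> mf f0; have mnp := measurable_normal_pdf m (1 : R).
rewrite !ge0_integral_normal1//; last first.
  by apply: measurableT_comp => //; exact: measurable_fun_subl.
rewrite -[RHS](@ge0_integral_subl _ (m *+ 2)); last 2 first.
- by apply: emeasurable_funM => //; exact/measurable_EFinP.
- by move=> x; rewrite mule_ge0// lee_fin normal_pdf_ge0.
apply: eq_integral => x _; rewrite !normal_pdf1E.
by rewrite (_ : (m *+ 2 - x - m) ^+ 2 = (x - m) ^+ 2)//; ring.
Qed.

(** The exponential is the ratio of the density of N(0, 1) to that of N(m, 1), since [(x - m)^2 / 2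
    + (m x - m^2 / 2) = x^2 / 2]. *)
Lemma ge0_integral_normal1_change (m : R) (f : R -> \bar R) :
  measurable_fun [set: R] f -> (forall x, 0 <= f x)%E ->
  (\int[normal1 m]_x (f x * (expR (- (m * x - m ^+ 2 / 2)))%:E) =
   \int[normal1 0]_x f x)%E.
Proof.
move=> mf f0; rewrite !ge0_integral_normal1//.
- apply: eq_integral => x _; rewrite -muleA -EFinM; congr (_ * _%:E)%E.
  by rewrite !normal_pdf1E mulrCA -expRD; congr (_ * expR _); field.
- apply: emeasurable_funM => //; apply/measurable_EFinP.
  apply: measurableT_comp => //; apply: measurable_funN.
  by apply: measurable_funB => //; exact: measurable_funM.
- by move=> x; rewrite mule_ge0// lee_fin expR_ge0.
Qed.

End normal1_integral.

(** * Integrals against product laws on tuples *)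

Section prod_tuple_integral.
Context {d} {T : measurableType d} {R : realType}.

Lemma ge0_integral_prod_tupleS n (P : 'I_n.+1 -> probability T R)
    (F : n.+1.-tuple T -> \bar R) :
  measurable_fun setT F -> (forall u, 0 <= F u)%E ->
  (\int[prod_tuple P]_u F u =
   \int[P ord0]_x \int[prod_tuple (fun i => P (lift ord0 i))]_u
     F (cons_pair (x, u)))%E.
Proof.
move=> mF F0; rewrite /= ge0_integral_distribution//.
rewrite fubini_tonelli1//.
  by apply: measurableT_comp => //; exact: measurable_cons_pair.
by move=> x; exact: F0.
Qed.

Lemma measurable_fubini_cons n (P : probability (n.-tuple T) R)
    (F : n.+1.-tuple T -> \bar R) :
  measurable_fun setT F -> (forall u, 0 <= F u)%E ->
  measurable_fun setT (fun x => \int[P]_u F (cons_pair (x, u)))%E.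
Proof.
move=> mF F0.
apply: (@measurable_fun_fubini_tonelli_F _ _ _ _ _ P (F \o @cons_pair _ _ n)) => //.
  by apply: measurableT_comp => //; exact: measurable_cons_pair.
by move=> x; exact: F0.
Qed.

Definition map_coord n (f : 'I_n -> T -> T) (u : n.-tuple T) : n.-tuple T :=
  [tuple f i (tnth u i) | i < n].

Lemma map_coord_cons n (f : 'I_n.+1 -> T -> T) x (u : n.-tuple T) :
  map_coord f (cons_pair (x, u)) =
  cons_pair (f ord0 x, map_coord (fun i => f (lift ord0 i)) u).
Proof.
apply: eq_from_tnth => i; rewrite tnth_mktuple.
by case: (unliftP ord0 i) => [j|] ->; rewrite ?tnthS ?tnth_mktuple.
Qed.

Lemma measurable_map_coord n (f : 'I_n -> T -> T) :
  (forall i, measurable_fun setT (f i)) -> measurable_fun setT (map_coord f).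
Proof.
move=> mf; apply/measurable_fun_tnthP => i.
rewrite (_ : _ \o _ = f i \o @tnth _ T ^~ i); last first.
  by apply/funext => u /=; rewrite tnth_mktuple.
by apply: measurableT_comp => //; exact: measurable_tnth.
Qed.

Lemma measurable_prod_coord n (g : 'I_n -> T -> R) :
  (forall i, measurable_fun setT (g i)) ->
  measurable_fun setT (fun u : n.-tuple T => \prod_i g i (tnth u i)).
Proof.
move=> mg; apply: measurable_prod => i _.
by apply: measurableT_comp => //; exact: measurable_tnth.
Qed.

(** Induction on [n]: Tonelli isolates the first coordinate, treated by the one-dimensional
    hypothesis, and the others fall to the induction hypothesis. With weights 1 this gives the
    Gaussian reflection, and with identity maps the change of mean. *)
Lemma ge0_integral_prod_tuple_transfer n (P Q : 'I_n -> probability T R)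
    (f : 'I_n -> T -> T) (g : 'I_n -> T -> R) (F : n.-tuple T -> \bar R) :
  (forall i, measurable_fun setT (f i)) ->
  (forall i, measurable_fun setT (g i)) -> (forall i x, 0 <= g i x) ->
  (forall i (h : T -> \bar R), measurable_fun setT h -> (forall x, 0 <= h x)%E ->
    \int[P i]_x (h (f i x) * (g i x)%:E) = \int[Q i]_x h x)%E ->
  measurable_fun setT F -> (forall u, 0 <= F u)%E ->
  (\int[prod_tuple P]_u (F (map_coord f u) * (\prod_i g i (tnth u i))%:E) =
   \int[prod_tuple Q]_u F u)%E.
Proof.
elim: n P Q f g F => [|n IH] P Q f g F mf mg g0 PQ mF F0.
  rewrite /= !integral_dirac//; last first.
    apply: emeasurable_funM; last first.
      by apply/measurable_EFinP; exact: measurable_prod_coord.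
    by apply: measurableT_comp => //; exact: measurable_map_coord.
  by rewrite big_ord0 mule1; congr (_ * F _)%E; exact: tuple0.
rewrite !ge0_integral_prod_tupleS//; last 2 first.
- apply: emeasurable_funM; last first.
    by apply/measurable_EFinP; exact: measurable_prod_coord.
  by apply: measurableT_comp => //; exact: measurable_map_coord.
- by move=> u; rewrite mule_ge0// lee_fin prodr_ge0.
have mcons x : measurable_fun setT (fun u : n.-tuple T => F (cons_pair (x, u))).
  apply: (@measurableT_comp _ _ _ _ _ _ (F \o @cons_pair _ _ n)).
    by apply: measurableT_comp => //; exact: measurable_cons_pair.
  exact: pair1_measurable.
(* The one-dimensional hypothesis is used for the first coordinate, with [h] the inner integral over
   the remaining coordinates. *)
rewrite -PQ//; last 2 first.
- exact: measurable_fubini_cons.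
- by move=> x; exact: integral_ge0.
apply: eq_integral => x _.
under eq_integral.
  move=> u _; rewrite map_coord_cons big_ord_recl EFinM.
  under eq_bigr do rewrite tnthS.
  rewrite muleCA (_ : tnth _ ord0 = x)//; over.
rewrite ge0_integralZl_EFin//; last 2 first.
  - by move=> u _; rewrite mule_ge0// lee_fin prodr_ge0.
  - apply: emeasurable_funM; last first.
      apply/measurable_EFinP.
      exact: (measurable_prod_coord (g := fun i => g (lift ord0 i))).

    apply: (measurableT_comp (mcons _)).
    exact: (measurable_map_coord (f := fun i => f (lift ord0 i))).
rewrite muleC; congr (_ * _)%E.
apply: (IH (fun i => P (lift ord0 i)) (fun i => Q (lift ord0 i))
  (fun i => f (lift ord0 i)) (fun i => g (lift ord0 i))
  (fun u => F (cons_pair (f ord0 x, u)))) => // i h mh h0.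
exact: PQ.
Qed.

End prod_tuple_integral.

Section gauss_integral.
Context {R : realType} {d : nat}.
Implicit Types u v w : d.-tuple R.
Local Notation zero := [tuple (0 : R) | i < d].

Definition reflect_at w v : d.-tuple R :=
  [tuple tnth w i *+ 2 - tnth v i | i < d].

Lemma measurable_reflect_at w : measurable_fun setT (reflect_at w).
Proof.
apply: (measurable_map_coord (f := fun i (x : R) => tnth w i *+ 2 - x)) => i.
exact: measurable_fun_subl.
Qed.

(** [w] is the midpoint of [v] and its reflection. Both [gauss_tilt_reflect] and [lin_reflect] rest
    on this. *)
Lemma dotDr_reflect u w v : dot u v + dot u (reflect_at w v) = dot u w *+ 2.
Proof.
rewrite /dot -big_split -sumrMnl; apply: eq_bigr => i _ /=.
by rewrite tnth_mktuple; ring.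
Qed.

Lemma dotC u v : dot u v = dot v u.
Proof. by apply: eq_bigr => i _; rewrite mulrC. Qed.

Lemma enorm_sqr w : enorm w ^+ 2 = dot w w.
Proof.
rewrite sqr_sqrtr; last by apply: sumr_ge0 => i _; rewrite sqr_ge0.
by apply: eq_bigr => i _; rewrite expr2.
Qed.

Lemma measurable_dot w : measurable_fun setT (dot w).
Proof.
apply: measurable_sum => i; apply: measurable_funM => //.
exact: measurable_tnth.
Qed.

Lemma ge0_integral_gauss_reflect w (F : d.-tuple R -> \bar R) :
  measurable_fun setT F -> (forall u, 0 <= F u)%E ->
  (\int[gauss w]_u F (reflect_at w u) = \int[gauss w]_u F u)%E.
Proof.
move=> mF F0.
rewrite -[RHS](@ge0_integral_prod_tuple_transfer _ _ _ _
  (fun i => normal1 (tnth w i)) _ (fun i (x : R) => tnth w i *+ 2 - x) (fun _ _ => 1))//.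
- by apply: eq_integral => u _; rewrite big1_eq mule1.
- by move=> i; exact: measurable_fun_subl.
- move=> i h mh h0; rewrite -[RHS]ge0_integral_normal1_reflect//.
  by apply: eq_integral => x _; rewrite mule1.
Qed.

(* The Radon-Nikodym derivative of N(0, I) with respect to N(w, I) is
   exp (- gauss_tilt w), so gauss_tilt w integrates to KL(N(w, I) || N(0, I)). *)
Definition gauss_tilt w v : R := dot w v - enorm w ^+ 2 / 2.

Lemma measurable_gauss_tilt w : measurable_fun setT (gauss_tilt w).
Proof. by apply: measurable_funB => //; exact: measurable_dot. Qed.

(** Averaged over a vector and its reflection, the tilt, which has no fixed sign, becomes the
    constant [enorm w ^+ 2 / 2], the relative entropy. *)
Lemma gauss_tilt_reflect w v :
  gauss_tilt w v + gauss_tilt w (reflect_at w v) = enorm w ^+ 2.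
Proof.
have := dotDr_reflect w w v; rewrite /gauss_tilt enorm_sqr; lra.
Qed.

(** The coordinatewise density ratios multiply to [expR (- gauss_tilt w u)]. *)
Lemma ge0_integral_gauss_change w (F : d.-tuple R -> \bar R) :
  measurable_fun setT F -> (forall u, 0 <= F u)%E ->
  (\int[gauss w]_u (F u * (expR (- gauss_tilt w u))%:E) =
   \int[gauss zero]_u F u)%E.
Proof.
move=> mF F0.
have := @ge0_integral_prod_tuple_transfer _ R R d
  (fun i => normal1 (tnth w i)) (fun i => normal1 (tnth zero i))
  (fun i (x : R) => x)
  (fun i (x : R) => expR (- (tnth w i * x - tnth w i ^+ 2 / 2))) F.
move=> H; apply: eq_trans (H _ _ _ _ mF F0) => {H}.
- apply: eq_integral => u _; congr (F _ * _%:E)%E.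
    by apply: eq_from_tnth => i; rewrite tnth_mktuple.
  rewrite -expR_sum; congr expR.
  rewrite /gauss_tilt enorm_sqr sumrN sumrB -mulr_suml.
  by congr (- (_ - _ / _)); apply: eq_bigr => i _; rewrite expr2.
- by [].
- move=> i; apply: measurableT_comp => //; apply: measurable_funN.
  by apply: measurable_funB => //; exact: measurable_funM.
- by move=> i x; rewrite expR_ge0.
- move=> i h mh h0.
  by rewrite [tnth zero i]tnth_mktuple ge0_integral_normal1_change.
Qed.

Lemma ge0_integral_gauss2_reflect w (F : d.-tuple R * d.-tuple R -> \bar R) :
  measurable_fun setT F -> (forall g, 0 <= F g)%E ->
  (\int[gauss w \x gauss w]_g F (reflect_at w g.1, reflect_at w g.2) =
   \int[gauss w \x gauss w]_g F g)%E.
Proof.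
move=> mF F0; have mr := measurable_reflect_at w.
rewrite !fubini_tonelli1//; last first.
  apply: measurableT_comp => //.
  by apply: measurable_fun_pair; apply: measurableT_comp.
rewrite /fubini_F -[RHS]ge0_integral_gauss_reflect//=; last 2 first.
- exact: (measurable_fun_fubini_tonelli_F).
- by move=> u; exact: integral_ge0.
apply: eq_integral => u _.
rewrite (@ge0_integral_gauss_reflect w (fun v => F (reflect_at w u, v)))//.
by apply: measurableT_comp => //; exact: pair1_measurable.
Qed.

(** Tonelli allows one change of mean per factor, and the two tilts add up. *)
Lemma ge0_integral_gauss2_change w (F : d.-tuple R * d.-tuple R -> \bar R) :
  measurable_fun setT F -> (forall g, 0 <= F g)%E ->
  (\int[gauss w \x gauss w]_g
      (F g * (expR (- (gauss_tilt w g.1 + gauss_tilt w g.2)))%:E) =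
   \int[gauss zero \x gauss zero]_g F g)%E.
Proof.
move=> mF F0.
have mt v : measurable_fun setT (fun u => (expR (- gauss_tilt v u))%:E).
  apply/measurable_EFinP; apply: measurableT_comp => //; apply: measurable_funN.
  exact: measurable_gauss_tilt.
rewrite [RHS]fubini_tonelli1// [LHS]fubini_tonelli1; last 2 first.
- apply: emeasurable_funM => //; apply/measurable_EFinP.
  apply: measurableT_comp => //; apply: measurable_funN.
  by apply: measurable_funD; (apply: measurableT_comp; first exact: measurable_gauss_tilt).
- by move=> g; rewrite mule_ge0// lee_fin expR_ge0.
rewrite /fubini_F -[RHS](ge0_integral_gauss_change w)//=; last 2 first.
- exact: (measurable_fun_fubini_tonelli_F).
- by move=> u; exact: integral_ge0.
apply: eq_integral => u _.
rewrite -(@ge0_integral_gauss_change w (fun v => F (u, v)))//; last first.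
  by apply: measurableT_comp => //; exact: pair1_measurable.
rewrite -ge0_integralZr ?lee_fin ?expR_ge0//; last 2 first.
- apply: emeasurable_funM => //.
  by apply: measurableT_comp => //; exact: pair1_measurable.
- by move=> v _; rewrite mule_ge0// lee_fin expR_ge0.
apply: eq_integral => v _; rewrite -muleA -EFinM -expRD; congr (_ * (expR _)%:E)%E.
by rewrite opprD addrC.
Qed.

End gauss_integral.

(** * The PAC-Bayes bound *)

Section exponential_moment.
Context {d} {T : measurableType d} {R : realType} (P : probability T R).

Lemma probability_fineK (A : set T) : measurable A -> (fine (P A))%:E = P A.
Proof. by move=> mA; rewrite fineK// fin_num_measure. Qed.

Lemma measurable_sum_coord n (f : T -> R) : measurable_fun setT f ->
  measurable_fun setT (fun u : n.-tuple T => \sum_i f (tnth u i)).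
Proof.
move=> mf; apply: measurable_sum => i.
by apply: measurableT_comp => //; exact: measurable_tnth.
Qed.

(** By independence the moment of the sum is a product of [n] moments, each at most 1; the induction
    peels off the first coordinate. *)
Lemma iid_exp_moment n (f : T -> R) : measurable_fun setT f ->
  (\int[P]_x (expR (f x))%:E <= 1)%E ->
  (\int[iid n P]_u (expR (\sum_i f (tnth u i)))%:E <= 1)%E.
Proof.
move=> mf f1; rewrite /iid; elim: n => [|n IH].
  have mF := @measurable_sum_coord 0 _ mf.
  rewrite /= integral_dirac//; last first.
    by apply/measurable_EFinP; exact: measurableT_comp.
  by rewrite big_ord0 expR0 mule1 diracT.
rewrite ge0_integral_prod_tupleS; last 2 first.
- apply/measurable_EFinP; apply: measurableT_comp => //.
  exact: measurable_sum_coord.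
- by move=> u; rewrite lee_fin expR_ge0.
apply: le_trans f1; apply: ge0_le_integral => //.
- by move=> x _; apply: integral_ge0 => u _; rewrite lee_fin expR_ge0.
- apply: (@measurable_fubini_cons _ _ _ _ _
    (fun u : n.+1.-tuple T => (expR (\sum_i f (tnth u i)))%:E)); last first.
    by move=> u; rewrite lee_fin expR_ge0.
  apply/measurable_EFinP; apply: measurableT_comp => //.
  exact: measurable_sum_coord.
- by apply/measurable_EFinP; exact: measurableT_comp.
move=> x _; under eq_integral.
  move=> u _; rewrite big_ord_recl expRD EFinM.
  under eq_bigr do rewrite tnthS.
  rewrite (_ : tnth _ ord0 = x)//; over.
rewrite ge0_integralZl_EFin ?expR_ge0//; last first.
  apply/measurable_EFinP; apply: measurableT_comp => //.
  exact: measurable_sum_coord.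
by rewrite -[leRHS]mule1 lee_wpmul2l// lee_fin expR_ge0.
Qed.

(* exp (- c 1_A) = 1 - (1 - exp (- c)) 1_A, then 1 - x <= exp (- x). *)
Lemma exp_moment_indic (A : set T) (c : R) : measurable A ->
  (\int[P]_x (expR ((1 - expR (- c)) * fine (P A) - c * \1_A x))%:E <= 1)%E.
Proof.
move=> mA; set a := 1 - expR (- c); set L := fine (P A).
have mI : measurable_fun setT (EFin \o \1_A : T -> \bar R).
  by apply/measurable_EFinP; exact: measurable_indic.
have mIC : measurable_fun setT (EFin \o \1_(~` A) : T -> \bar R).
  by apply/measurable_EFinP; apply: measurable_indic; exact: measurableC.
rewrite (eq_integral (fun x => (expR (a * L))%:E * (\1_(~` A) x)%:E +
   (expR (a * L - c))%:E * (\1_A x)%:E)%E); last first.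
  move=> x _; rewrite !indicE in_setC; case: (x \in A) => /=.
    by rewrite mulr1 mule0 mule1 add0e.
  by rewrite mulr0 subr0 mule0 mule1 adde0.
rewrite ge0_integralD//; [|exact: measurable_funeM..].
rewrite !ge0_integralZl_EFin ?expR_ge0// !integral_indic ?setIT//; last first.
  exact: measurableC.
rewrite [X in (_ * X + _)%E]probability_setC//.
rewrite [X in (_ + _ * X)%E](_ : _ = L%:E) ?probability_fineK//.
rewrite -[P A]probability_fineK// -/L -EFinB -!EFinM -EFinD lee_fin.
rewrite expRD -mulrA -mulrDr (_ : _ + _ = 1 + - (a * L)); last first.
  by rewrite /a; ring.
rewrite (le_trans (ler_wpM2l _ (expR_ge1Dx _)))// ?expR_ge0//.
by rewrite expRN divff// gt_eqF// expR_gt0.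
Qed.

End exponential_moment.

Section pac_bayes.
Context {dG dZ} {G : measurableType dG} {Z : measurableType dZ} {R : realType}.
Variables (P : probability G R) (D : probability Z R) (E : set (G * Z)).
Hypothesis mE : measurable E.
Variables (c : R) (m : nat).

Let a : R := 1 - expR (- c).
Let L g : R := fine (D (xsection E g)).

(* E is the set of pairs (hypothesis, example) incurring a loss. *)
Definition catoni_exponent (g : G) (u : m.-tuple Z) : R :=
  \sum_i (a * L g - c * \1_E (g, tnth u i)).

Let mL : measurable_fun setT L.
Proof.
apply: (measurableT_comp (fine_measurable _)) => //.
exact: measurable_fun_xsection.
Qed.

Lemma measurable_catoni_exponent :
  measurable_fun setT (fun p : G * m.-tuple Z => catoni_exponent p.1 p.2).
Proof.
apply: measurable_sum => i; apply: measurable_funB.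
  by apply: measurable_funM => //; apply: (measurableT_comp mL).
apply: measurable_funM => //.
apply: (@measurableT_comp _ _ _ _ _ _ (\1_E : _ -> R) setT
  (fun p : G * m.-tuple Z => (p.1, tnth p.2 i))); first exact: measurable_indic.
apply: measurable_fun_pair => //.
by apply: (measurableT_comp (measurable_tnth i)).
Qed.

(** For a fixed [g] the losses on the sample are independent indicators of mean [L g], so the
    one-point estimate [exp_moment_indic] applies to each coordinate. *)
Lemma catoni_exponent_moment g :
  (\int[iid m D]_u (expR (catoni_exponent g u))%:E <= 1)%E.
Proof.
have mEg : measurable (xsection E g) by exact: measurable_xsection.
apply: (@iid_exp_moment _ _ _ _ _ (fun z => a * L g - c * \1_E (g, z))).
  apply: measurable_funB => //; apply: measurable_funM => //.
  apply: (@measurableT_comp _ _ _ _ _ _ (\1_E : _ -> R) setT (pair g)).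
    exact: measurable_indic.
  exact: pair1_measurable.
under eq_integral do rewrite indicE -mem_xsection -indicE.
exact: exp_moment_indic.
Qed.

Let mexp : measurable_fun setT
  (fun p : G * m.-tuple Z => (expR (catoni_exponent p.1 p.2))%:E).
Proof.
apply/measurable_EFinP; apply: measurableT_comp => //.
exact: measurable_catoni_exponent.
Qed.

(** Only the prior [P] enters this event, so what is deduced on it holds for all posteriors
    simultaneously. *)
Definition catoni_event (delta : R) : set (m.-tuple Z) :=
  [set u | \int[P]_g (expR (catoni_exponent g u))%:E <= (delta^-1)%:E]%E.

Let Gm u := (\int[P]_g (expR (catoni_exponent g u))%:E)%E.

Let mGm : measurable_fun setT Gm.
Proof.
apply: (@measurable_fun_fubini_tonelli_G _ _ _ _ _ P
  (fun p : G * m.-tuple Z => (expR (catoni_exponent p.1 p.2))%:E)) => //.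
Qed.

Lemma measurable_catoni_event delta : measurable (catoni_event delta).
Proof. by rewrite -[catoni_event _]setTI; exact: emeasurable_fun_infty_c. Qed.

(** Tonelli exchanges the prior and the sample, so the pointwise moment bound gives [Gm] mean at
    most 1; Markov's inequality concludes. *)
Lemma probability_catoni_event (delta : R) : 0 < delta ->
  ((1 - delta)%:E <= iid m D (catoni_event delta))%E.
Proof.
move=> delta0; have mA := measurable_catoni_event delta.
have Gm0 u : (0 <= Gm u)%E by apply: integral_ge0 => g _; rewrite lee_fin expR_ge0.
have intG : (\int[iid m D]_u Gm u <= 1)%E.
  have := @fubini_tonelli _ _ _ _ _ P (iid m D) _ mexp.
  rewrite /fubini_G /Gm /= => <- //.
  rewrite -[leRHS](@probability_setT _ _ _ P) -[leRHS]mul1e -integral_cst//.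
  apply: ge0_le_integral => //.
  - by move=> g _; apply: integral_ge0 => u _; rewrite lee_fin expR_ge0.
  - apply: (@measurable_fun_fubini_tonelli_F _ _ _ _ _ (iid m D)
      (fun p : G * m.-tuple Z => (expR (catoni_exponent p.1 p.2))%:E)) => //.
  - by move=> g _; exact: catoni_exponent_moment.
have dV0 : 0 < delta^-1 by rewrite invr_gt0.
(* Markov's inequality concerns the set where [|Gm|] is at least [delta^-1], which contains the
   complement of the event, where the inequality is strict. *)
have markov : ((delta^-1)%:E * iid m D (~` catoni_event delta) <= 1)%E.
  apply: le_trans intG; under [leRHS]eq_integral do rewrite -(gee0_abs (Gm0 _)).
  apply: le_trans (le_integral_abse _ measurableT mGm dV0).
  rewrite lee_wpmul2l// ?lee_fin ?(ltW dV0)//.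
  rewrite le_measure// ?inE.
  - exact: measurableC.
  - have mGabs : measurable_fun setT (fun u => `|Gm u|%E) by exact: measurableT_comp.
    exact: emeasurable_fun_c_infty.
  - move=> u /=; rewrite /catoni_event/= => /negP; rewrite -ltNge => /ltW h.
    by split => //; rewrite (le_trans h)// lee_abs.
move: markov; rewrite probability_setC// -probability_fineK// -EFinB -EFinM !lee_fin.
rewrite -ler_pdivlMl// invrK mulr1; lra.
Qed.

End pac_bayes.

(** As [r] preserves [mu], twice each integral is the integral of the function plus its composite
    with [r], so it suffices to compare these sums. This serves both to remove the tilt in
    [catoni_bound] and to compare [h_w] with the Gibbs classifier. *)
Lemma ge0_le_integral_symmetrized {d} {T : measurableType d} {R : realType}
    (mu : {measure set T -> \bar R}) (r : T -> T) (f1 f2 : T -> \bar R) :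
  measurable_fun setT r ->
  (forall F : T -> \bar R, measurable_fun setT F -> (forall x, 0 <= F x)%E ->
    \int[mu]_x F (r x) = \int[mu]_x F x)%E ->
  measurable_fun setT f1 -> (forall x, 0 <= f1 x)%E ->
  measurable_fun setT f2 -> (forall x, 0 <= f2 x)%E ->
  (forall x, f1 x + f1 (r x) <= f2 x + f2 (r x))%E ->
  (\int[mu]_x f1 x <= \int[mu]_x f2 x)%E.
Proof.
move=> mr muE mf1 f10 mf2 f20 f12.
have mf1r : measurable_fun setT (fun x => f1 (r x)) by exact: measurableT_comp.
have mf2r : measurable_fun setT (fun x => f2 (r x)) by exact: measurableT_comp.
rewrite -(@lee_pmul2l _ 2%:E)// !mule_natl !mule2n.
rewrite -{2}(muE f1)// -{2}(muE f2)// -!ge0_integralD//.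
apply: ge0_le_integral => //.
- by move=> x _; rewrite adde_ge0.
- exact: emeasurable_funD.
- exact: emeasurable_funD.
Qed.

Lemma probability_integral_cst {d} {T : measurableType d} {R : realType}
    (P : probability T R) (y : \bar R) : (\int[P]_x y = y)%E.
Proof. by rewrite integral_cst// [X in (_ * X)%E]probability_setT mule1. Qed.

(** An average of probabilities lies between 0 and 1. Finiteness lets the final inequalities be
    settled in the reals. *)
Lemma integral_section_fin_num {dG dZ} {G : measurableType dG}
    {Z : measurableType dZ} {R : realType} (Q : probability G R)
    (P : probability Z R) (E : set (G * Z)) : measurable E ->
  (\int[Q]_g P (xsection E g) \is a fin_num)%E.
Proof.
move=> mE; rewrite ge0_fin_numE; last exact: integral_ge0.
apply: (@le_lt_trans _ _ 1%E); last exact: ltry.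
rewrite -[leRHS](probability_integral_cst Q).
apply: ge0_le_integral => //; first exact: measurable_fun_xsection.
by move=> g _; exact: probability_le1 (measurable_xsection _ _).
Qed.

Section pac_bayes_bound.
Context {dG dZ} {G : measurableType dG} {Z : measurableType dZ} {R : realType}.
Variables (P Q : probability G R) (D : probability Z R) (E : set (G * Z)).
Hypothesis mE : measurable E.
Variables (c delta k : R) (m : nat).
Hypotheses (c0 : 0 < c) (m0 : (0 < m)%N) (delta0 : 0 < delta)
  (delta1 : delta <= 1) (k0 : 0 <= k).
Variables (phi : G -> R) (r : G -> G).
Hypotheses (mphi : measurable_fun setT phi) (mr : measurable_fun setT r).
Hypothesis change : forall F : G -> \bar R, measurable_fun setT F ->
  (forall g, 0 <= F g)%E ->
  (\int[Q]_g (F g * (expR (- phi g))%:E) = \int[P]_g F g)%E.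
Hypothesis invariant : forall F : G -> \bar R, measurable_fun setT F ->
  (forall g, 0 <= F g)%E -> (\int[Q]_g F (r g) = \int[Q]_g F g)%E.
Hypothesis phir : forall g, phi g + phi (r g) = k *+ 2.

(* exp (- phi) = dP/dQ, so k = KL(Q || P). In place of Jensen's inequality,
   x + 1 <= exp x is used at x = X g - phi g - ln (1 / delta), X the Catoni
   exponent; summed over the Q-preserving involution r, the possibly
   non-integrable phi disappears and all the integrands are nonnegative. *)
Lemma catoni_bound (u : m.-tuple Z) : catoni_event P D E c delta u ->
  let c' := c / (1 - expR (- c)) in
  (\int[Q]_g D (xsection E g) <=
   c'%:E * ((m%:R^-1)%:E * \sum_(i < m) Q (ysection E (tnth u i)))
   + (c' / (m%:R * c) * (k + ln delta^-1))%:E)%E.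
Proof.
move=> uA; set a := 1 - expR (- c); set K := k + ln delta^-1 => /=.
have a0 : 0 < a by rewrite /a subr_gt0 expR_lt1 oppr_lt0.
have mR0 : 0 < m%:R :> R by rewrite ltr0n.
have K0 : 0 <= K by rewrite addr_ge0// ln_ge0// invf_ge1.
set X := fun g => catoni_exponent D E c g u.
have mX : measurable_fun setT X.
  apply: (@measurableT_comp _ _ _ _ _ _
    (fun p : G * m.-tuple Z => catoni_exponent D E c p.1 p.2) setT (pair^~ u)).
    exact: measurable_catoni_exponent.
  exact: pair2_measurable.
have mD : measurable_fun setT (fun g => D (xsection E g)).
  exact: measurable_fun_xsection.
have mEy i : measurable (ysection E (tnth u i)) by exact: measurable_ysection.
pose N g : R := \sum_(i < m) \1_(ysection E (tnth u i)) g.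
have mN : measurable_fun setT N.
  by apply: measurable_sum => i; exact: measurable_indic.
have N0 g : 0 <= N g by apply: sumr_ge0 => i _; rewrite indicE.
have XE g : X g = m%:R * a * fine (D (xsection E g)) - c * N g.
  rewrite /X /catoni_exponent sumrB sumr_const card_ord -mulr_sumr.
  rewrite -/a -[_ *+ m]mulr_natl mulrA; congr (_ - c * _); apply: eq_bigr => i _.
  by rewrite !indicE mem_ysection.
have DE g : (fine (D (xsection E g)))%:E = D (xsection E g).
  by apply: probability_fineK; exact: measurable_xsection.
(* [f1] and [f2] are the two sides of the exponential inequality, rearranged so that every term is
   nonnegative. Outside the exponential in [h], [phi] is replaced by its average [k], contained in
   [K]. *)
pose f1 g : \bar R := ((m%:R * a)%:E * D (xsection E g) + 1)%E.
pose h g : \bar R := ((expR (X g))%:E * (expR (- phi g))%:E)%E.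
pose f2 g : \bar R := (c%:E * (N g)%:E + (K%:E + delta%:E * h g))%E.
have h0 g : (0 <= h g)%E by rewrite mule_ge0.
have mh : measurable_fun setT h.
  apply: emeasurable_funM; apply/measurable_EFinP; apply: measurableT_comp => //.
  exact: measurable_funN.
have mdh : measurable_fun setT (fun g => delta%:E * h g)%E by exact: measurable_funeM.
have mf2' : measurable_fun setT (fun g => K%:E + delta%:E * h g)%E.
  exact: emeasurable_funD.
have mcN : measurable_fun setT (fun g => c%:E * (N g)%:E)%E.
  by apply: measurable_funeM; exact/measurable_EFinP.
have dh0 g : (0 <= delta%:E * h g)%E by rewrite mule_ge0// lee_fin ltW.
have f2'0 g : (0 <= K%:E + delta%:E * h g)%E by rewrite adde_ge0.
have cN0 g : (0 <= c%:E * (N g)%:E)%E by rewrite mule_ge0// lee_fin// ltW.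
have maD0 g : (0 <= (m%:R * a)%:E * D (xsection E g))%E.
  by rewrite mule_ge0// lee_fin mulr_ge0// ltW.
have : (\int[Q]_g f1 g <= \int[Q]_g f2 g)%E.
  apply: (ge0_le_integral_symmetrized mr) => //.
  - by apply: emeasurable_funD => //; exact: measurable_funeM.
  - by move=> g; rewrite adde_ge0.
  - exact: emeasurable_funD.
  - by move=> g; rewrite adde_ge0.
  move=> g; rewrite /f1 /f2 /h -(DE g) -(DE (r g)) -!EFinM -!EFinD lee_fin -!expRD.
  have key x : X x - phi x - ln delta^-1 + 1 <= delta * expR (X x - phi x).
    rewrite addrC (le_trans (expR_ge1Dx _))// -lnV ?posrE ?invr_gt0// invrK.
    by rewrite expRD lnK ?posrE// mulrC.
  have := key g; have := key (r g); have := phir g; rewrite !XE /K; lra.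
rewrite /f1 /f2 ge0_integralD//; last first.
  exact: measurable_funeM.
rewrite ge0_integralZl_EFin//; last by rewrite mulr_ge0// ltW.
rewrite probability_integral_cst.
rewrite ge0_integralD// ge0_integralZl_EFin//; last 3 first.
- by move=> g _; rewrite lee_fin.
- exact/measurable_EFinP.
- exact: ltW.
rewrite ge0_integralD// probability_integral_cst.
rewrite ge0_integralZl_EFin//; last exact: ltW.
(* The change of measure turns the posterior integral of [h] into the prior average that defines the
   event. *)
rewrite /h change//; last by apply/measurable_EFinP; exact: measurableT_comp.
have -> : (\int[Q]_g (N g)%:E = \sum_(i < m) Q (ysection E (tnth u i)))%E.
  under eq_integral do rewrite -sumEFin.
  rewrite ge0_integral_sum//; last 1 first.
    by move=> i; apply/measurable_EFinP; exact: measurable_indic.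
  by apply: eq_bigr => i _; rewrite integral_indic// setIT.
set I := (\int[Q]_g D _)%E; set J := (\sum_(i < m) _)%E.
have Ifin : I \is a fin_num by exact: integral_section_fin_num.
have Jfin : J \is a fin_num by apply/sum_fin_numP => i _ _; exact: fin_num_measure.
(* On the event this term is at most 1, which cancels the constant 1 in [f1]. *)
have dP1 : (delta%:E * \int[P]_g (expR (X g))%:E <= 1)%E.
  rewrite -[leRHS](_ : (delta%:E * (delta^-1)%:E = 1)%E).
    by rewrite lee_wpmul2l// lee_fin ltW.
  by rewrite -EFinM divff// gt_eqF.
move=> /le_trans /(_ (leeD2l _ (leeD2l _ dP1))).
rewrite -(fineK Ifin) -(fineK Jfin) -!EFinM -!EFinD !lee_fin => IJ.
rewrite -(ler_pM2l (mulr_gt0 mR0 a0)).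
have -> : m%:R * a * (c / a * (m%:R^-1 * fine J) + c / a / (m%:R * c) * K) =
  c * fine J + K by field; rewrite !gt_eqF.
lra.
Qed.

End pac_bayes_bound.

(** * Linear classifiers *)

Section bool_sets.
Context {d} {T : measurableType d}.

Lemma measurable_bool_set (f : T -> bool) : measurable_fun setT f ->
  measurable [set x | f x].
Proof. by move=> /(_ measurableT [set true] I); rewrite setTI. Qed.

Lemma measurable_fun_neqb (f g : T -> bool) : measurable_fun setT f ->
  measurable_fun setT g -> measurable_fun setT (fun x => f x != g x).
Proof.
move=> mf mg; rewrite (_ : (fun _ => _) = fun x => if f x then ~~ g x else g x).
  by apply: measurable_fun_ifT => //; exact: measurable_neg.
by apply/funext => x; case: (f x); case: (g x).
Qed.

End bool_sets.

Section evaluation.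
Context {Z : Type} {H : set (classifier Z)} (H0 : H !=set0).

Lemma measurable_eval (z : Z) :
  measurable_fun setT (fun h : trace H0 => trace_val h z).
Proof.
apply: (@measurableT_comp _ _ _ _ _ _ (fun h : classifier Z => h z)); last first.
  exact: measurable_trace_val.
apply: (measurable_fun_bool true) => //; rewrite setTI.
by apply: sub_sigma_algebra; exists z.
Qed.

End evaluation.

Section linear.
Context {R : realType} {d : nat} {X : set (d.-tuple R)} (X0 : X !=set0).
Variable s0 : bool.
Local Notation L := (lin s0 X0).

(** Joint measurability in weights and inputs makes the loss sets below measurable in the product
    space, as integration over their sections requires. *)
Lemma measurable_lin_pair :
  measurable_fun setT (fun p : d.-tuple R * trace X0 => L p.1 p.2).
Proof.
have mdot : measurable_fun setT
    (fun p : d.-tuple R * trace X0 => dot p.1 (trace_val p.2)).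
  apply: measurable_sum => i; apply: measurable_funM.
    by apply: (measurableT_comp (measurable_tnth i)).
  apply: (measurableT_comp (measurable_tnth i)).
  by apply: (measurableT_comp (@measurable_trace_val _ _ _ X0)).
rewrite /lin /sgn; apply: measurable_fun_ifT => //.
  exact: measurable_fun_eqr.
exact: measurable_fun_ltr.
Qed.

(** This set and [joint_error] are the loss sets for the PAC-Bayes bound. A hypothesis there is a
    pair of weight vectors rather than of classifiers, since the reflection and the Gaussian
    densities live on weights. *)
Definition disagreement : set ((d.-tuple R * d.-tuple R) * trace X0) :=
  [set p | L p.1.1 p.2 != L p.1.2 p.2].

Definition joint_error : set ((d.-tuple R * d.-tuple R) * (trace X0 * bool)) :=
  [set p | (L p.1.1 p.2.1 != p.2.2) && (L p.1.2 p.2.1 != p.2.2)].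

Lemma measurable_lin_comp {dT} {T : measurableType dT} (f : T -> d.-tuple R)
    (g : T -> trace X0) : measurable_fun setT f -> measurable_fun setT g ->
  measurable_fun setT (fun x => L (f x) (g x)).
Proof.
move=> mf mg; apply: (@measurableT_comp _ _ _ _ _ _
  (fun p : d.-tuple R * trace X0 => L p.1 p.2) setT (fun x => (f x, g x))).
  exact: measurable_lin_pair.
exact: measurable_fun_pair.
Qed.

Lemma measurable_disagreement : measurable disagreement.
Proof.
apply: measurable_bool_set; apply: measurable_fun_neqb.
  by apply: measurable_lin_comp => //; exact: measurableT_comp.
by apply: measurable_lin_comp => //; exact: measurableT_comp.
Qed.

Lemma measurable_joint_error : measurable joint_error.
Proof.
apply: measurable_bool_set; apply: measurable_and.
  apply: measurable_fun_neqb; last exact: measurableT_comp.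
  by apply: measurable_lin_comp => //; exact: measurableT_comp.
apply: measurable_fun_neqb; last exact: measurableT_comp.
by apply: measurable_lin_comp => //; exact: measurableT_comp.
Qed.

(** The score of [w] at [x] is the mean of the scores of [v] and its reflection. If it is nonzero,
    one of these has its sign. If it is zero, they are both zero or of opposite signs, so one of
    them yields the label [s0], whichever it is. *)
Lemma lin_reflect (w v : d.-tuple R) (x : trace X0) :
  L v x = L w x \/ L (reflect_at w v) x = L w x.
Proof.
have := dotDr_reflect (trace_val x) w v.
rewrite /lin /sgn !(dotC _ (trace_val x)).
set p := dot _ v; set q := dot _ (reflect_at w v); set r := dot _ w => pqr.
have [p0|p0|p0] := ltrgtP p 0; have [q0|q0|q0] := ltrgtP q 0;
  have [r0|r0|r0] := ltrgtP r 0;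
  first [by left | by right | by case: s0; (left + right) | exfalso; lra].
Qed.

End linear.
Arguments disagreement {R d X} X0 s0 _.
Arguments joint_error {R d X} X0 s0 _.

(** * Densities, the divergence and the target mass outside the source support *)

Section density_bounds.
Local Open Scope ereal_scope.
Context {R : realType} {disp} {Z : measurableType disp}.
Variables (mu : {measure set Z -> \bar R}) (S T : probability Z R).
Variables (s t : {mfun Z >-> R}).
Hypotheses (Ss : is_density mu S s) (Tt : is_density mu T t).

Lemma measure0_compl_supp : T (~` supp t) = 0.
Proof.
have [t0 ->] := Tt; last exact/measurableC/measurable_supp.
apply: integral0_eq => z /= /negP; rewrite /supp /= -leNgt => tz.
by congr (_%:E); apply/eqP; rewrite eq_le tz t0.
Qed.

(** An empty support would give [S] total mass 0. Hence the supremum in [beta_infty] is not over the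
    empty set, where it would be [-oo]. *)
Lemma supp_nonempty : supp s !=set0.
Proof.
apply/set0P/negP => /eqP s0.
have [sge0 /(_ _ measurableT)] := Ss; rewrite integral0_eq => [|z _].
  by rewrite probability_setT => /eqP; rewrite onee_eq0.
congr (_%:E); apply/eqP; rewrite eq_le sge0 andbT leNgt; apply/negP => sz.
by have : supp s z by []; rewrite s0.
Qed.

Lemma beta_infty_ge0 : 0 <= beta_infty t s.
Proof.
have [z sz] := supp_nonempty.
apply: le_trans (ereal_sup_ubound _); last by exists z.
by rewrite lee_fin divr_ge0// ?(Tt.1 z)// (Ss.1 z).
Qed.

(** On [supp s] the definition of the supremum gives [t <= beta * s] pointwise, and this is
    integrated. *)
Lemma measureI_supp_le (beta : R) (A : set Z) : beta_infty t s = beta%:E ->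
  measurable A -> T (A `&` supp s) <= beta%:E * S A.
Proof.
move=> betaE mA; have [t0 tE] := Tt; have [s0 sE] := Ss.
have mS := measurable_supp s; have mAs : measurable (A `&` supp s) by exact: measurableI.
have ms D : measurable_fun D (EFin \o s) by apply/measurable_EFinP; exact: measurable_funTS.
have mt D : measurable_fun D (EFin \o t) by apply/measurable_EFinP; exact: measurable_funTS.
have beta0 : (0 <= beta)%R by rewrite -lee_fin -betaE beta_infty_ge0.
apply: (@le_trans _ _ (beta%:E * S (A `&` supp s))); last first.
  by rewrite lee_wpmul2l ?lee_fin// le_measure// ?inE.
rewrite tE// sE// -ge0_integralZl_EFin//; last by move=> z _; rewrite lee_fin.
apply: ge0_le_integral => //.
- by move=> z _; rewrite lee_fin.
- exact: measurable_funeM.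
move=> z [_ sz]; rewrite -EFinM lee_fin -ler_pdivrMr// -lee_fin -betaE.
by apply: ereal_sup_ubound; exists z.
Qed.

(** The conditional law is normalized by the mass of [supp t] minus [supp s], which is the factor on
    the left because [T] gives no mass to the complement of [supp t]. *)
Lemma law_diffE (B : set Z) : measurable B ->
  T (~` supp s) * law_diff T t s B = T (B `\` supp s).
Proof.
move=> mB; have mst := measurable_supp t; have mss := measurable_supp s.
have mDB B' : measurable B' -> T (B' `\` supp s) = T (B' `&` (supp t `\` supp s)).
  move=> mB'; have mBs : measurable (B' `\` supp s) by exact: measurableD.
  rewrite -[LHS](_ : T ((B' `\` supp s) `&` supp t) + 0 = _).
    by rewrite adde0; congr (T _); apply/seteqP; split => z /=; tauto.
  rewrite -(_ : T ((B' `\` supp s) `&` ~` supp t) = 0).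
    rewrite -measureU//; [|exact: measurableI|by apply: measurableI=> //; exact: measurableC|].
      by rewrite -setIUr setUv setIT.
    by rewrite setIACA setICr setI0.
  apply: (subset_measure0 _ _ (@subIsetr _ _ _) measure0_compl_supp).
    by apply: measurableI=> //; exact: measurableC.
  exact: measurableC.
have Tst : T (~` supp s) = T (supp t `\` supp s).
  by rewrite -setTD mDB// setTI.
have mD : measurable (supp t `\` supp s) by exact: measurableD.
rewrite mDB// Tst /law_diff /cond_law /= /mnormalize /=.
rewrite (_ : mrestr _ _ setT = T (supp t `\` supp s)); last first.
  by rewrite /mrestr setTI.
(* When the conditioning set is null, [mnormalize] returns its default value and both sides vanish;
   infinite mass is impossible. *)
case: ifPn => [/orP[/eqP D0|/eqP Doo]|].
- rewrite [X in X * _]D0 mul0e; apply/esym.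
  by apply: (subset_measure0 _ _ (@subIsetr _ _ _) D0) => //; exact: measurableI.
- by have := fin_num_measure T _ mD; rewrite [X in X \is a fin_num]Doo.
rewrite negb_or => /andP[D0 _].
rewrite muleCA -[X in _ * (X * _)]probability_fineK// -EFinM divff ?mule1//.
by rewrite fine_eq0// fin_num_measure.
Qed.

End density_bounds.

Lemma indic_bool_set {T : Type} {R : realType} (f : T -> bool) (x : T) :
  \1_[set x | f x] x = (f x)%:R :> R.
Proof.
by rewrite indicE (_ : (x \in _) = f x)//; apply/idP/idP; rewrite inE.
Qed.

(** * Risks of one and of two linear classifiers *)

Section linear_risk.
Local Open Scope ereal_scope.
Context {R : realType} {d : nat} {X : set (d.-tuple R)} (X0 : X !=set0).
Variable s0 : bool.
Local Notation L := (lin s0 X0).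

Definition error_set (w : d.-tuple R) : set (trace X0 * bool) :=
  [set z | L w z.1 != z.2].

Lemma measurable_error_set w : measurable (error_set w).
Proof.
apply: measurable_bool_set; apply: measurable_fun_neqb => //.
exact: measurable_lin_comp.
Qed.

Lemma risk_linE (P : probability (trace X0 * bool)%type R) w :
  risk P (L w) = P (error_set w).
Proof.
rewrite /risk; under eq_integral do rewrite -indic_bool_set.
by rewrite integral_indic ?setIT//; exact: measurable_error_set.
Qed.

(** Where [h_w] errs, so does whichever of the other two classifiers agrees with it there; the union
    bound concludes. *)
Lemma risk_lin_reflect (P : probability (trace X0 * bool)%type R) w v :
  risk P (L w) <= risk P (L v) + risk P (L (reflect_at w v)).
Proof.
rewrite !risk_linE; have mE := measurable_error_set.
apply: (@le_trans _ _ (P (error_set v `|` error_set (reflect_at w v)))).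
  rewrite le_measure// ?inE//; first exact: measurableU.
  by move=> z; rewrite /error_set /=; have [->|->] := lin_reflect s0 w v z.1;
    [left|right].
exact: measureU2.
Qed.

Lemma xsection_disagreement v w :
  xsection (disagreement X0 s0) (v, w) = [set x | L v x != L w x].
Proof. by apply/seteqP; split => x; rewrite /xsection /= inE. Qed.

Lemma xsection_joint_error v w :
  xsection (joint_error X0 s0) (v, w) = error_set v `&` error_set w.
Proof.
by apply/seteqP; split => x; rewrite /xsection /= inE => /andP.
Qed.

(* I[h != y] + I[h' != y] = I[h != h'] + 2 I[h != y] I[h' != y] *)
Lemma risk_lin_pair (P : probability (trace X0 * bool)%type R) v w :
  risk P (L v) + risk P (L w) =
  marginal P (xsection (disagreement X0 s0) (v, w)) +
  2%:E * P (xsection (joint_error X0 s0) (v, w)).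
Proof.
rewrite xsection_disagreement xsection_joint_error !risk_linE.
have mE := measurable_error_set.
have mI : measurable (error_set v `&` error_set w) by exact: measurableI.
have mdis : measurable [set z : trace X0 * bool | L v z.1 != L w z.1].
  apply: measurable_bool_set.
  by apply: measurable_fun_neqb; exact: measurable_lin_comp.
rewrite [marginal P _](_ : _ = P [set z | L v z.1 != L w z.1])//.
have indicS A : measurable A -> P A = \int[P]_z (\1_A z)%:E.
  by move=> mA; rewrite integral_indic ?setIT.
have mi A : measurable A -> measurable_fun setT (EFin \o (\1_A : trace X0 * bool -> R)).
  by move=> mA; apply/measurable_EFinP; exact: measurable_indic.
rewrite !indicS// -ge0_integralZl_EFin//; last exact: mi.
rewrite -!ge0_integralD//; try exact: mi; last first.
  by apply: measurable_funeM; exact: mi.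
apply: eq_integral => z _; rewrite -EFinM -!EFinD indicI; congr (_%:E).
rewrite /= !indic_bool_set.
case: (L v z.1) (L w z.1) z.2 => [] [] [] /=; ring.
Qed.

End linear_risk.
Arguments error_set {R d X} X0 s0 w _.

(** * Empirical quantities as Gaussian measures of sections *)

Section empirical.
Local Open Scope ereal_scope.
Context {R : realType} {d : nat} {X : set (d.-tuple R)} (X0 : X !=set0).
Variable s0 : bool.
Local Notation L := (lin s0 X0).
Local Notation gauss2 w := (gauss w \x gauss w).

(** [rho] is the image of a Gaussian law, so both integrals are pulled back to weights and joined by
    Tonelli. A classifier enters only through its value at [x], hence measurability reduces to that
    of evaluations. *)
Lemma integral_rho2 (w : d.-tuple R) (x : trace X0) (f : bool -> bool -> R) :
  (forall a b, (0 <= f a b)%R) ->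
  \int[rho s0 X0 w]_h \int[rho s0 X0 w]_h' (f (trace_val h x) (trace_val h' x))%:E =
  \int[gauss2 w]_g (f (L g.1 x) (L g.2 x))%:E.
Proof.
move=> f0.
have mev (h : bool -> \bar R) :
    measurable_fun setT (fun k : trace (linH_nonempty s0 X0) => h (trace_val k x)).
  by apply: (measurableT_comp (f := h)) => //; exact: measurable_eval.
have minner (a : bool) :
    \int[rho s0 X0 w]_h' (f a (trace_val h' x))%:E =
    \int[gauss w]_v (f a (L v x))%:E.
  rewrite ge0_integral_distribution//; last by move=> h; rewrite lee_fin.
  exact: (mev (fun b => (f a b)%:E)).
under eq_integral do rewrite minner.
rewrite ge0_integral_distribution//; last 2 first.
- exact: (mev (fun a => \int[gauss w]_v (f a (L v x))%:E)).
- by move=> h; apply: integral_ge0 => v _; rewrite lee_fin.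
rewrite fubini_tonelli1//; last by move=> g; rewrite lee_fin.
rewrite (_ : (fun _ => _) = fun g : d.-tuple R * d.-tuple R =>
  if L g.1 x then if L g.2 x then (f true true)%:E else (f true false)%:E
  else if L g.2 x then (f false true)%:E else (f false false)%:E).
  have mL1 : measurable_fun setT (fun g : d.-tuple R * d.-tuple R => L g.1 x).
    exact: measurable_lin_comp.
  have mL2 : measurable_fun setT (fun g : d.-tuple R * d.-tuple R => L g.2 x).
    exact: measurable_lin_comp.
  by apply: (measurable_fun_ifT mL1); exact: (measurable_fun_ifT mL2).
by apply/funext => g; case: (L g.1 x); case: (L g.2 x).
Qed.

(** This is the form in which the empirical term appears in [catoni_bound]. *)
Lemma emp_disagreement_rho m (u : m.-tuple (trace X0)) (w : d.-tuple R) :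
  emp_disagreement u (rho s0 X0 w) =
  (m%:R^-1)%:E *
    \sum_(i < m) gauss2 w (ysection (disagreement X0 s0) (tnth u i)).
Proof.
congr (_ * _); apply: eq_bigr => i _.
rewrite (@integral_rho2 _ _ (fun a b => (a != b)%:R))//.
under eq_integral do rewrite -indic_bool_set.
rewrite integral_indic ?setIT//; last first.
  apply: measurable_bool_set.
  by apply: measurable_fun_neqb; exact: measurable_lin_comp.
by congr (gauss2 w _); apply/seteqP; split => g; rewrite /ysection /= inE.
Qed.

Lemma emp_joint_error_rho m (u : m.-tuple (trace X0 * bool)) (w : d.-tuple R) :
  emp_joint_error u (rho s0 X0 w) =
  (m%:R^-1)%:E *
    \sum_(i < m) gauss2 w (ysection (joint_error X0 s0) (tnth u i)).
Proof.
congr (_ * _); apply: eq_bigr => i _.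
set x := (tnth u i).1; set y := (tnth u i).2.
rewrite (@integral_rho2 _ _ (fun a b => (a != y)%:R * (b != y)%:R)%R)//.
under eq_integral do rewrite -natrM mulnb -indic_bool_set.
rewrite integral_indic ?setIT//; last first.
  apply: measurable_bool_set; apply: measurable_and;
    by apply: measurable_fun_neqb => //; exact: measurable_lin_comp.
by congr (gauss2 w _); apply/seteqP; split => g; rewrite /ysection /= inE.
Qed.

Lemma sum_section_ge0_fin_num {dZ} {Z : measurableType dZ} {dG}
    {G : measurableType dG} (Q : probability G R) (E : set (G * Z)) m
    (u : m.-tuple Z) : measurable E ->
  let e := (m%:R^-1)%:E * \sum_(i < m) Q (ysection E (tnth u i)) in
  0 <= e /\ e \is a fin_num.
Proof.
move=> mE /=; split; first by rewrite mule_ge0// sume_ge0.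
rewrite fin_numM//; apply/sum_fin_numP => i _ _.
by apply: fin_num_measure; exact: measurable_ysection.
Qed.

Lemma emp_disagreement_ge0_fin_num m (u : m.-tuple (trace X0)) w :
  0 <= emp_disagreement u (rho s0 X0 w) /\
  emp_disagreement u (rho s0 X0 w) \is a fin_num.
Proof.
rewrite emp_disagreement_rho; apply: sum_section_ge0_fin_num.
exact: measurable_disagreement.
Qed.

Lemma emp_joint_error_ge0_fin_num m (u : m.-tuple (trace X0 * bool)) w :
  0 <= emp_joint_error u (rho s0 X0 w) /\
  emp_joint_error u (rho s0 X0 w) \is a fin_num.
Proof.
rewrite emp_joint_error_rho; apply: sum_section_ge0_fin_num.
exact: measurable_joint_error.
Qed.

End empirical.

(** * From the source to the target *)

Section domain_adaptation.
Local Open Scope ereal_scope.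
Context {R : realType} {d : nat} {X : set (d.-tuple R)} (X0 : X !=set0).
Variable s0 : bool.
Local Notation L := (lin s0 X0).
Local Notation gauss2 w := (gauss w \x gauss w).
Local Notation joint v := (xsection (joint_error X0 s0) v).
Local Notation disagree v := (xsection (disagreement X0 s0) v).

(** By [risk_lin_pair] the right-hand side is the mean of the sum of two risks, twice the Gibbs
    risk. Symmetrizing under the simultaneous reflection of both vectors bounds the constant risk of
    [h_w] by it. *)
Lemma risk_lin_le_gauss (T : probability (trace X0 * bool)%type R) w :
  risk T (L w) <= \int[gauss2 w]_g marginal T (disagree g) +
    2%:E * \int[gauss2 w]_g T (joint g).
Proof.
have mD : measurable_fun setT (fun g => marginal T (disagree g)).
  apply: measurable_fun_xsection; exact: measurable_disagreement.
have mJ : measurable_fun setT (fun g => T (joint g)).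
  apply: measurable_fun_xsection; exact: measurable_joint_error.
have m2J : measurable_fun setT (fun g => 2%:E * T (joint g)).
  exact: measurable_funeM.
rewrite -ge0_integralZl_EFin// -ge0_integralD//; last first.
  by move=> g _; rewrite mule_ge0.
rewrite -[leLHS](probability_integral_cst (gauss2 w)).
apply: (ge0_le_integral_symmetrized
  (r := fun g => (reflect_at w g.1, reflect_at w g.2))) => //.
- by apply: measurable_fun_pair;
    apply: measurableT_comp => //; exact: measurable_reflect_at.
- by move=> F mF F0; exact: ge0_integral_gauss2_reflect.
- by move=> g; rewrite risk_linE.
- exact: emeasurable_funD.
- by move=> g; rewrite adde_ge0// mule_ge0.
(* Of the four risks on the right, each vector is regrouped with its own reflection. *)
move=> [v1 v2] /=; rewrite -!risk_lin_pair [leRHS]addeACA.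
by rewrite leeD//; exact: risk_lin_reflect.
Qed.

Section densities.
Variables (mu : {measure set (trace X0 * bool)%type -> \bar R}).
Variables (S T : probability (trace X0 * bool)%type R).
Variables (s t : {mfun (trace X0 * bool)%type >-> R}).
Hypotheses (Ss : is_density mu S s) (Tt : is_density mu T t).
Local Notation eta := (eta_diff (linH s0 X0) T t s).

Lemma measureD_supp_le_eta v : T (error_set X0 s0 v `\` supp s) <= eta.
Proof.
rewrite -(law_diffE s Tt); last exact: measurable_error_set.
rewrite lee_wpmul2l//; apply: ereal_sup_ubound; exists (L v); first by exists v.
by rewrite risk_linE.
Qed.

Lemma eta_diff_ge0 : 0 <= eta.
Proof. exact: le_trans (measureD_supp_le_eta point). Qed.

(** The joint error is split along [supp s]. Inside, the density ratio bounds it; outside, it is at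
    most the error of the first classifier alone, so [eta] is paid only once. *)
Lemma joint_error_le (beta : R) g : beta_infty t s = beta%:E ->
  T (joint g) <= beta%:E * S (joint g) + eta.
Proof.
move=> betaE; have mJ : measurable (joint g).
  apply: measurable_xsection; exact: measurable_joint_error.
have mS := measurable_supp s.
have mE v : measurable (error_set X0 s0 v) by exact: measurable_error_set.
rewrite -[leLHS](_ : T (joint g `&` supp s) + T (joint g `\` supp s) = _).
  rewrite leeD//; first exact: (measureI_supp_le Ss Tt).
  apply: le_trans (measureD_supp_le_eta g.1).
  rewrite le_measure// ?inE//; [exact: measurableD|exact: measurableD|].
  by case: g {mJ} => v w /=; rewrite xsection_joint_error => z [[? _] ?].
by rewrite addeC -measureDI.
Qed.

Lemma integral_joint_error_le (beta : R) w : beta_infty t s = beta%:E ->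
  \int[gauss2 w]_g T (joint g) <=
  beta%:E * \int[gauss2 w]_g S (joint g) + eta.
Proof.
move=> betaE; have beta0 : (0 <= beta)%R.
  by rewrite -lee_fin -betaE (beta_infty_ge0 Ss Tt).
have eta0 := eta_diff_ge0.
have mJ (P : probability _ R) : measurable_fun setT (fun g => P (joint g)).
  apply: measurable_fun_xsection; exact: measurable_joint_error.
rewrite -ge0_integralZl_EFin// -[X in _ + X](probability_integral_cst (gauss2 w)).
rewrite -ge0_integralD//; last 2 first.
- by move=> g _; rewrite mule_ge0.
- exact: measurable_funeM.
apply: ge0_le_integral => //.
- by apply: emeasurable_funD => //; exact: measurable_funeM.
- by move=> g _; exact: joint_error_le.
Qed.

End densities.

Local Notation zero := [tuple (0 : R)%R | i < d].

(** Here [k] is [enorm w ^+ 2]: each factor of the posterior contributes relative entropy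
    [enorm w ^+ 2 / 2]. The event involves only the centred prior, hence does not depend on [w]. *)
Lemma catoni_gauss {dZ} {Z : measurableType dZ} (D : probability Z R)
    (E : set ((d.-tuple R * d.-tuple R) * Z)) (c delta : R) m
    (u : m.-tuple Z) (w : d.-tuple R) :
  measurable E -> (0 < c)%R -> (0 < m)%N -> (0 < delta)%R -> (delta <= 1)%R ->
  catoni_event (gauss2 zero) D E c delta u ->
  let c' := (c / (1 - expR (- c)))%R in
  \int[gauss2 w]_g D (xsection E g) <=
  c'%:E * ((m%:R^-1)%:E * \sum_(i < m) gauss2 w (ysection E (tnth u i)))
   + (c' / (m%:R * c) * (enorm w ^+ 2 + ln delta^-1))%:E.
Proof.
move=> mE c0 m0 delta0 delta1 uA.
apply: (@catoni_bound _ _ _ _ _ (gauss2 zero) (gauss2 w) D E mE c delta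
  (enorm w ^+ 2)%R m c0 m0 delta0 delta1 _
  (fun g => gauss_tilt w g.1 + gauss_tilt w g.2)%R
  (fun g => (reflect_at w g.1, reflect_at w g.2)) _ _ _ _ _ u uA).
- by rewrite sqr_ge0.
- apply: measurable_funD; first exact: (measurableT_comp (measurable_gauss_tilt w)).
  exact: (measurableT_comp (measurable_gauss_tilt w)).
- by apply: measurable_fun_pair;
    apply: measurableT_comp => //; exact: measurable_reflect_at.
- by move=> F mF F0; exact: ge0_integral_gauss2_change.
- by move=> F mF F0; exact: ge0_integral_gauss2_reflect.
- by move=> [v1 v2] /=; rewrite addrACA !gauss_tilt_reflect mulr2n.
Qed.

End domain_adaptation.

(** * Independence of the samples and conclusion *)

Lemma with_prob_ge_prod {d1 d2} {T1 : measurableType d1} {T2 : measurableType d2}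
    {R : realType} (P1 : probability T1 R) (P2 : probability T2 R) (delta : R)
    (A1 : set T1) (A2 : set T2) (E : set (T1 * T2)) :
  delta <= 1 -> measurable A1 -> measurable A2 ->
  ((1 - delta / 2)%:E <= P1 A1)%E -> ((1 - delta / 2)%:E <= P2 A2)%E ->
  A1 `*` A2 `<=` E -> with_prob_ge (P1 \x P2)%E (1 - delta) E.
Proof.
move=> delta1 mA1 mA2 PA1 PA2 AE; exists (A1 `*` A2); split => //.
  exact: measurableX.
rewrite [leRHS]product_measure1E//.
have ge0 : 0 <= 1 - delta / 2 by lra.
apply: (le_trans _ (lee_pmul _ _ PA1 PA2)) => //.
by rewrite -EFinM lee_fin -subr_ge0; have := sqr_ge0 (delta / 2); rewrite expr2; lra.
Qed.

Theorem corollary8 (R : realType) (d : nat) (X : set (d.-tuple R))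
    (X0 : X !=set0) (s0 : bool)
    (mu : {measure set (trace X0 * bool)%type -> \bar R})
    (S T : probability (trace X0 * bool)%type R)
    (s t : {mfun (trace X0 * bool)%type >-> R})
    (Ss : is_density mu S s) (Tt : is_density mu T t)
    (ms mt : nat) (ms_ge1 : (1 <= ms)%N) (mt_ge1 : (1 <= mt)%N)
    (delta : R) (delta_gt0 : 0 < delta) (delta_le1 : delta <= 1)
    (b c : R) (b_gt0 : 0 < b) (c_gt0 : 0 < c) :
  let b' : \bar R := ((b / (1 - expR (- b)))%:E * beta_infty t s)%E in
  let c' : R := c / (1 - expR (- c)) in
  with_prob_ge (iid ms S \x iid mt (marginal T))%E (1 - delta)
    [set ST : ms.-tuple (trace X0 * bool) * mt.-tuple (trace X0) |
      forall w : d.-tuple R,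
      (risk T (lin s0 X0 w) <=
         c'%:E * emp_disagreement ST.2 (rho s0 X0 w)
       + 2%:E * b' * emp_joint_error ST.1 (rho s0 X0 w)
       + 2%:E * eta_diff (linH s0 X0) T t s
       + 2%:E * ((c' / (mt%:R * c))%:E + b' * ((ms%:R * b)^-1)%:E)
           * (enorm w ^+ 2 + ln (2 / delta))%:E)%E].
Proof.
move=> b' c'.
pose prior := gauss [tuple (0 : R) | i < d].
have delta2_gt0 : 0 < delta / 2 by lra.
have delta2_le1 : delta / 2 <= 1 by lra.
have mD : measurable (disagreement X0 s0) by exact: measurable_disagreement.
have mJ : measurable (joint_error X0 s0) by exact: measurable_joint_error.
(* Each sample gets confidence [delta / 2], whence [ln (2 / delta)]. The events are fixed before [w]
   is introduced. *)
apply: (@with_prob_ge_prod _ _ _ _ _ _ _ _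
  (catoni_event (prior \x prior)%E S (joint_error X0 s0) b (delta / 2))
  (catoni_event (prior \x prior)%E (marginal T) (disagreement X0 s0) c (delta / 2))) => //.
- exact: measurable_catoni_event.
- exact: measurable_catoni_event.
- exact: probability_catoni_event.
- exact: probability_catoni_event.
move=> [u v] [/= uA vA] w.
have KE : ln (delta / 2)^-1 = ln (2 / delta) by rewrite invf_div.
have /= bD := catoni_gauss w mD c_gt0 mt_ge1 delta2_gt0 delta2_le1 vA.
have /= bJ := catoni_gauss w mJ b_gt0 ms_ge1 delta2_gt0 delta2_le1 uA.
rewrite KE -(@emp_disagreement_rho _ _ _ _ s0 _ v w) -/c' in bD.
rewrite KE -(@emp_joint_error_rho _ _ _ _ s0 _ u w) in bJ.
have fracM (x : R) : 0 < x -> 0 < x / (1 - expR (- x)).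
  by move=> x0; rewrite divr_gt0// subr_gt0 expR_lt1 oppr_lt0.
have c'0 : 0 < c' := fracM _ c_gt0.
have mtR0 : 0 < mt%:R :> R by rewrite ltr0n.
have msR0 : 0 < ms%:R :> R by rewrite ltr0n.
have K0 : 0 < enorm w ^+ 2 + ln (2 / delta).
  by rewrite ltr_wpDl ?sqr_ge0// ln_gt0// ltr_pdivlMr//; lra.
have beta0 := beta_infty_ge0 Ss Tt.
have eta0 := eta_diff_ge0 s0 s Tt.
have [D0 Dfin] := emp_disagreement_ge0_fin_num s0 v w.
have [J0 Jfin] := emp_joint_error_ge0_fin_num s0 u w.
rewrite /b'; case betaE: (beta_infty t s) beta0 => [beta| |//]; last first.
  (* If the divergence is infinite, the last summand is [+oo] because all its other factors are
     strictly positive. The remaining summands are nonnegative, so the whole right-hand side is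
     [+oo]. *)
  move=> _; rewrite gt0_muley ?lte_fin ?fracM// gt0_mulye; last first.
    by rewrite lte_fin invr_gt0 mulr_gt0.
  rewrite [((c' / _)%:E + +oo)%E](_ : _ = +oo%E)//.
  rewrite [X in (_ + X)%E](_ : _ = +oo%E); last first.
    by rewrite gt0_muley// gt0_mulye// lte_fin.
  rewrite addey ?leey//.
  rewrite gt_eqF// (lt_le_trans (ltNyr 0))// !adde_ge0//.
  - by rewrite mule_ge0// lee_fin ltW.
  - by rewrite mule_ge0.
  - by rewrite mule_ge0.
rewrite lee_fin => beta0.
have TJ := integral_joint_error_le s0 Ss Tt w betaE.
have := risk_lin_le_gauss s0 T w.
have TJfin : (\int[gauss w \x gauss w]_g T (xsection (joint_error X0 s0) g))%E
  \is a fin_num by exact: integral_section_fin_num.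
have SJfin : (\int[gauss w \x gauss w]_g S (xsection (joint_error X0 s0) g))%E
  \is a fin_num by exact: integral_section_fin_num.
have TDfin : (\int[gauss w \x gauss w]_g
    marginal T (xsection (disagreement X0 s0) g))%E
  \is a fin_num by exact: integral_section_fin_num.
move: TJ bJ bD.
rewrite -(fineK TJfin) -(fineK SJfin) -(fineK TDfin) -(fineK Dfin) -(fineK Jfin).
move: (fine _) (fine _) (fine _) (fine _) (fine _) => eD eJ tD sJ tJ.
move=> TJ bJ bD /le_trans; apply.
case: (eta_diff _ _ _ _) eta0 TJ => [eta| |//] eta0; last first.
  by move=> _; rewrite gt0_muley// addey// addye// leey.
rewrite -?EFinM -?EFinD !lee_fin in bJ bD * => TJ.
(* The source bound is scaled by [beta], to be chained with the comparison [TJ] of target and source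
   joint errors. *)
have := ler_wpM2l beta0 bJ.
(* The disagreement bound contributes this term once while the statement has it twice; its sign
   covers the difference. *)
have : 0 <= c' / (mt%:R * c) * (enorm w ^+ 2 + ln (2 / delta)).
  by apply/ltW/mulr_gt0 => //; rewrite divr_gt0// mulr_gt0.
move: bD TJ; set x := c' / _; set y := (ms%:R * b)^-1.
set B := b / (1 - _); set K := enorm w ^+ 2 + ln _.
lra.
Qed.
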